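(* Let $j\in\mathbb{Z}$. Let $n$ be a one-dimensional, real-valued, zero-mean, wide-sense stationary random process with autocovariance function $\Gamma_n$, and let $(n_{j,m}[k])_{k\in\mathbb{Z}}$ and $(n^{\mathrm H}_{j,m}[k])_{k\in\mathbb{Z}}$, $m\in\{0,\ldots,M-1\}$, be its primal and dual $M$-band wavelet coefficients at resolution level $j$. Then, for all $(m,m')\in\{0,\ldots,M-1\}^2$, $([n_{j,m}[k]\quad n^{\mathrm H}_{j,m}[k]])_{k\in\mathbb{Z}}$ is a wide-sense stationary vector sequence. More precisely, for all $(\ell,k)\in\mathbb{Z}^2$, $$\mathsf{E}\{n_{j,m}[k+\ell]\,n_{j,m'}[k]\}=\Gamma_{n_{j,m},n_{j,m'}}[\ell]=\int_{-\infty}^\infty \Gamma_n(x)\,\gamma_{\psi_m,\psi_{m'}}\Big(\frac{x}{M^j}-\ell\Big)dx,$$ $$\mathsf{E}\{n^{\mathrm H}_{j,m}[k+\ell]\,n^{\mathrm H}_{j,m'}[k]\}=\Gamma_{n^{\mathrm H}_{j,m},n^{\mathrm H}_{j,m'}}[\ell]=\int_{-\infty}^\infty \Gamma_n(x)\,\gamma_{\psi^{\mathrm H}_m,\psi^{\mathrm H}_{m'}}\Big(\frac{x}{M^j}-\ell\Big)dx,$$ $$\mathsf{E}\{n_{j,m}[k+\ell]\,n^{\mathrm H}_{j,m'}[k]\}=\Gamma_{n_{j,m},n^{\mathrm H}_{j,m'}}[\ell]=\int_{-\infty}^\infty \Gamma_n(x)\,\gamma_{\psi_m,\psi^{\mathrm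 H}_{m'}}\Big(\frac{x}{M^j}-\ell\Big)dx.$$
   Context: Fourier transform: $\widehat a(\omega)=\int a(t)e^{-\imath\omega t}dt$. $M\ge 2$ is an integer. $M$-band dual-tree wavelets: $\psi_0\in \mathrm L^2(\mathbb{R})$ is the (real-valued) scaling function and $\psi_1,\ldots,\psi_{M-1}\in \mathrm L^2(\mathbb{R})$ are the (real-valued) mother wavelets of an orthonormal $M$-band multiresolution analysis of $\mathrm L^2(\mathbb{R})$. They satisfy $\sqrt M\,\widehat\psi_m(M\omega)=H_m(\omega)\widehat\psi_0(\omega)$ for $m\in\{0,\ldots,M-1\}$, where the $H_m$ are $2\pi$-periodic frequency responses with $\sum_{p=0}^{M-1}H_m(\omega+p\frac{2\pi}{M})H_{m'}^*(\omega+p\frac{2\pi}{M})=M\delta_{m-m'}$ for all $m,m'\in\{0,\ldots,M-1\}$ ($\delta_0=1$ and $\delta_i=0$ for $i\neq0$); the functions $M^{-j/2}\psi_m(M^{-j}t-k)$, $1\le m\le M-1$, $j,k\in\mathbb{Z}$, form an orthonormal basis of $\mathrm L^2(\mathbb{R})$. The dual scaling function $\psi_0^{\mathrm H}$ and dual mother wavelets $\psi_m^{\mathrm H}$ (real-valued, in $\mathrm L^2(\mathbb{R})$), which define another orthonormal $M$-band wavelet basis, are given by $\widehat\psi{}_m^{\mathrm H}(\omega)=-\imath\,\mathrm{sign}(\omega)\widehat\psi_m(\omega)$ for $m\in\{1,\ldots,M-1\}$ and, with $d$ a fixed arbitrary integer, by $\widehat\psi{}_0^{\mathrm H}(\omega)=(-1)^k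 e^{-\imath(d+\frac12)\omega}\widehat\psi_0(\omega)$ if $\omega\in[2k\pi,2(k+1)\pi)$ with $k\in\mathbb{Z}$, $k\ge0$, and $\widehat\psi{}_0^{\mathrm H}(\omega)=(-1)^{k+1} e^{-\imath(d+\frac12)\omega}\widehat\psi_0(\omega)$ if $\omega\in[2k\pi,2(k+1)\pi)$ with $k\in\mathbb{Z}$, $k<0$. Autocovariance: $\Gamma_n(\tau)=\mathsf{E}\{n(x+\tau)n(x)\}$ for all $(\tau,x)\in\mathbb{R}^2$. Deterministic cross-correlation of real-valued $f,g\in \mathrm L^2(\mathbb{R})$: $\gamma_{f,g}(\tau)=\int_{-\infty}^\infty f(x)g(x-\tau)\,dx$ for all $\tau\in\mathbb{R}$. Coefficients: $n_{j,m}[k]=\int_{-\infty}^\infty n(x)M^{-j/2}\psi_m(M^{-j}x-k)\,dx$ and $n^{\mathrm H}_{j,m}[k]=\int_{-\infty}^\infty n(x)M^{-j/2}\psi^{\mathrm H}_m(M^{-j}x-k)\,dx$. For two sequences of random variables $u,v$, the symbol $\Gamma_{u,v}[\ell]$ denotes the covariance $\mathsf{E}\{u[k+\ell]v[k]\}$, when it does not depend on $k$.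
   Formalization: Added: for all ℓ the three covariance integrals converge absolutely as double integrals (with |Γ_n| and the cross-correlations of the absolute values of the wavelets); n is jointly measurable, and the coefficients are mean-square limits of the integrals over [-T,T]. *)

(* Defs.v *)
#[warnings="-notation-overridden,-notation-incompatible-prefix"]
From mathcomp Require Export all_boot all_order all_algebra.
From mathcomp Require Export complex.
From mathcomp Require Export all_classical all_reals all_analysis.

Set Implicit Arguments.
Unset Strict Implicit.
Unset Printing Implicit Defensive.

Import Order.TTheory GRing.Theory Num.Theory.
Import numFieldNormedType.Exports.

Local Open Scope classical_set_scope.
Local Open Scope ring_scope.

Section SquareIntegrable.
Context {R : realType}.
Notation mu := (@lebesgue_measure R).

Definition L2 (f : R -> R) : Prop := f \in Lfun mu 2%:E.

Definition inner (f g : R -> R) : R := \int[mu]_x (f x * g x).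

Definition crosscorr (f g : R -> R) (tau : R) : R :=
  \int[mu]_x (f x * g (x - tau)).

(* Closed linear span in L^2(R); [lincomb] allows repetitions in [s], which
   does not change the span. *)
Definition lincomb (I : Type) (e : I -> R -> R) (s : seq I) (a : I -> R) :
  R -> R := fun x => \sum_(i <- s) a i * e i x.

Definition closed_span (I : Type) (e : I -> R -> R) (f : R -> R) : Prop :=
  L2 f /\ forall eps : R, 0 < eps -> exists (s : seq I) (a : I -> R),
    ('N[mu]_2%:E [EFin \o (f \- lincomb e s a)%R] < eps%:E)%E.

Definition orthonormal_family (I : Type) (e : I -> R -> R) : Prop :=
  (forall i, L2 (e i)) /\
  (forall i, inner (e i) (e i) = 1) /\
  (forall i i', i <> i' -> inner (e i) (e i') = 0).

Definition orthonormal_basis (I : Type) (e : I -> R -> R) : Prop :=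
  orthonormal_family e /\ forall f, L2 f -> closed_span e f.

(* [F] is (a representative of) the Fourier transform of the real function
   [f] of L^2(R), with kernel exp(- i w t): the limit in L^2(R) of the
   transforms of the truncations of [f] to [-T, T]. *)
Definition is_fourier (f : R -> R) (F : R -> R[i]) : Prop :=
  measurable_fun setT (fun w => complex.Re (F w) : R) /\
  measurable_fun setT (fun w => complex.Im (F w) : R) /\
  (fun T : R => \int[mu]_w
     ((complex.Re (F w) - \int[mu]_(t in `[- T, T]) (f t * cos (w * t))) ^+ 2 +
      (complex.Im (F w) + \int[mu]_(t in `[- T, T]) (f t * sin (w * t))) ^+ 2)%:E)%E
    @ +oo --> 0%E.

Definition cexpi (theta : R) : R[i] := (cos theta +i* sin theta)%C.

End SquareIntegrable.

Section Wavelets.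
Context {R : realType}.
Notation mu := (@lebesgue_measure R).

(* x |-> M^(-j/2) f (M^(-j) x - k) *)
Definition atom (M : nat) (f : R -> R) (j k : int) : R -> R :=
  fun x => M%:R `^ (- (j%:~R / 2)) * f (M%:R ^ (- j) * x - k%:~R).

(* Resolution coarsens as [j] increases; V_j is the closed span of the
   [atom M phi j k], so f \in V_j <-> f (M .) \in V_(j-1) is automatic. *)
Definition mra_space (M : nat) (phi : R -> R) (j : int) : (R -> R) -> Prop :=
  closed_span (atom M phi j).

Record is_mra (M : nat) (phi : R -> R) : Prop := IsMra {
  mra_orthonormal : orthonormal_family (atom M phi 0) ;
  mra_nested : forall (j : int) f,
    mra_space M phi j f -> mra_space M phi (j - 1) f ;
  mra_separated : forall f, (forall j, mra_space M phi j f) ->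
    \forall x \ae mu, f x = 0 ;
  mra_dense : forall f, L2 f -> forall eps : R, 0 < eps ->
    exists (j : int) (g : R -> R), mra_space M phi j g /\
      ('N[mu]_2%:E [EFin \o (f \- g)%R] < eps%:E)%E }.

(* The index of the basis is (m, (j, k)) with 1 <= m <= M - 1. *)
Definition is_wavelet_basis (M : nat) (psi : nat -> R -> R) : Prop :=
  orthonormal_basis
    (fun i : {m : nat | (0 < m < M)%N} * (int * int) =>
       atom M (psi (sval i.1)) i.2.1 i.2.2).

(* [psi 0] is the scaling function, [psi m] for 1 <= m < M the mother
   wavelets (the values for m >= M are irrelevant); [hat] gives their Fourier
   transforms and [H] the frequency responses of the filter bank. *)
Record is_mband_wavelets (M : nat) (psi : nat -> R -> R)
    (hat H : nat -> R -> R[i]) : Prop := IsMbandWavelets {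
  mband_L2 : forall m, (m < M)%N -> L2 (psi m) ;
  mband_fourier : forall m, (m < M)%N -> is_fourier (psi m) (hat m) ;
  mband_mra : is_mra M (psi 0%N) ;
  mband_basis : is_wavelet_basis M psi ;
  mband_measurable : forall m, (m < M)%N ->
    measurable_fun setT (fun w => complex.Re (H m w) : R) /\
    measurable_fun setT (fun w => complex.Im (H m w) : R) ;
  mband_periodic : forall m, (m < M)%N -> forall w,
    H m (w + 2 * pi) = H m w ;
  mband_two_scale : forall m, (m < M)%N -> \forall w \ae mu,
    ((Num.sqrt M%:R)%:C)%C * hat m (M%:R * w) = H m w * hat 0%N w ;
  mband_paraunitary : forall m m', (m < M)%N -> (m' < M)%N ->
    \forall w \ae mu,
      \sum_(p < M) H m (w + p%:R * (2 * pi / M%:R)) *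
                   (H m' (w + p%:R * (2 * pi / M%:R)))^*
      = M%:R * (m == m')%:R }.

(* Dual wavelets: [hat] and [hatH] are the Fourier transforms of [psi] and
   [psiH]. *)
Record is_dual_wavelets (M : nat) (d : int) (psi psiH : nat -> R -> R)
    (hat hatH : nat -> R -> R[i]) : Prop := IsDualWavelets {
  dual_L2 : forall m, (m < M)%N -> L2 (psiH m) ;
  dual_fourier : forall m, (m < M)%N -> is_fourier (psiH m) (hatH m) ;
  dual_basis : is_wavelet_basis M psiH ;
  dual_mother : forall m, (0 < m < M)%N -> \forall w \ae mu,
    hatH m w = - 'i * ((Num.sg w)%:C)%C * hat m w ;
  dual_scaling : \forall w \ae mu, forall k : int,
    2 * k%:~R * pi <= w < 2 * (k + 1)%:~R * pi ->
    hatH 0%N w = (-1) ^ (if 0 <= k then k else k + 1) *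
                 cexpi (- ((d%:~R + 2^-1) * w)) * hat 0%N w }.

End Wavelets.

Section Processes.
Context {R : realType} {d : measure_display} {Omega : measurableType d}.
Variable P : probability Omega R.
Notation mu := (@lebesgue_measure R).

(* Zero-mean wide-sense stationary process with autocovariance [Gamma]. *)
Record is_zero_mean_wss (n : R -> Omega -> R) (Gamma : R -> R) : Prop :=
  IsZeroMeanWss {
  wss_measurable : measurable_fun setT
    (fun p : measurableTypeR R * Omega => n p.1 p.2) ;
  wss_L2 : forall x, n x \in Lfun P 2%:E ;
  wss_mean : forall x, 'E_P[n x]%E = 0%E ;
  wss_autocov : forall tau x : R,
    'E_P[fun w => (n (x + tau) w * n x w)%R]%E = (Gamma tau)%:E }.

(* [c] is the mean-square integral of [n(x) f(x)] over the real line, that is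
   the limit in L^2(P), as T tends to +oo, of the (pathwise, almost surely
   absolutely convergent) Lebesgue integrals over [-T, T].  It coincides with
   the pathwise integral over the line when
   E (\int |n(x) f(x)| dx)^2 is finite, but also makes sense for
   functions [f] of L^2 that are not integrable. *)
Definition is_ms_integral (n : R -> Omega -> R) (f : R -> R)
    (c : Omega -> R) : Prop :=
  c \in Lfun P 2%:E /\
  (fun T : R =>
     'E_P[fun w => ((c w - \int[mu]_(x in `[- T, T]) (n x w * f x)) ^+ 2)%R]%E)
    @ +oo --> 0%E.

Definition is_wavelet_coefficients (M : nat) (psi : nat -> R -> R)
    (n : R -> Omega -> R) (j : int) (c : nat -> int -> Omega -> R) : Prop :=
  forall m, (m < M)%N -> forall k : int,
    is_ms_integral n (atom M (psi m) j k) (c m k).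

Definition is_wss_vector_sequence (I : Type) (X : int -> I -> Omega -> R) :
  Prop :=
  (forall k a, X k a \in Lfun P 2%:E) /\
  (forall k k' a, 'E_P[X k a]%E = 'E_P[X k' a]%E) /\
  (forall l k k' a b, 'E_P[fun w => (X (k + l) a w * X k b w)%R]%E =
                      'E_P[fun w => (X (k' + l) a w * X k' b w)%R]%E).

(* The common value of E(u[k + l] v[k]) is [G l]. *)
Definition has_crosscov (u v : int -> Omega -> R) (G : int -> \bar R) : Prop :=
  forall l k : int, 'E_P[fun w => (u (k + l) w * v k w)%R]%E = G l.

End Processes.

Section CovarianceFormula.
Context {R : realType}.
Notation mu := (@lebesgue_measure R).

Definition covariance_integral (M : nat) (j : int) (Gamma f g : R -> R)
    (l : int) : \bar R :=
  (\int[mu]_x (Gamma x * crosscorr f g (x / M%:R ^ j - l%:~R))%:E)%E.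

(* Absolute convergence, as a double integral, of [covariance_integral]. *)
Definition covariance_integral_converges (M : nat) (j : int)
    (Gamma f g : R -> R) : Prop :=
  forall l : int,
    (covariance_integral M j (Num.norm \o Gamma) (Num.norm \o f)
       (Num.norm \o g) l < +oo)%E.

End CovarianceFormula.

(* Main.v *)
Require Import Defs.
From mathcomp Require Import measurable_realfun ring lra.

(** Why the theorem is true.

    A coefficient is a mean-square integral of the process n against an atom,
    and for a fixed Z of L^2(P) the map c |-> E(Z c) is continuous on L^2(P).
    Fubini on [-k, k] x Omega lets the expectation enter the truncated
    integrals, and dominated convergence removes the truncation: if c is the
    mean-square integral of n f, and x |-> E(Z n(x)) f(x) is integrable, then
      E(Z c) = \int E(Z n(x)) f(x) dx      ([expectation_ms_integral]).
    Since Z is arbitrary, no joint truncation of two coefficients ever has to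
    be considered; the formula is used three times:
    - with Z = 1, it shows that every coefficient has mean zero;
    - with Z = n(y), it gives E(n(y) c) = \int Gamma(x - y) f(x) dx, as soon
      as the right-hand side converges absolutely;
    - with Z = c and c' the mean-square integral of n g, it gives
      E(c c') = \int E(c n(y)) g(y) dy, where E(c n(y)) is now known.
    With x = z + y the result is a double integral of
    Gamma(z) f(z + y) g(y), whose absolute convergence justifies Fubini
    ([covariance_ms_integrals]).

    For f and g the atoms of index k + l and k, the integral in y is
    evaluated by an affine change of variable and equals the deterministic
    cross-correlation at z / M^j - l ([integral_atom_mul]).  Both the absolute
    convergence and the value of the double integral follow from this, and k
    has disappeared: this is the stationarity.  Primal and dual wavelets enter
    as square integrable functions, so one lemma covers the three formulas
    ([covariance_coefficients]).  For the stationarity of the vector sequence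
    there remains the covariance of a dual coefficient with a primal one, which
    is the primal-dual covariance at lag - l. *)

Set Implicit Arguments.
Unset Strict Implicit.
Unset Printing Implicit Defensive.

Import Order.TTheory GRing.Theory Num.Theory.
Import numFieldNormedType.Exports.

Local Open Scope classical_set_scope.
Local Open Scope ring_scope.

(** * Affine changes of variable for the Lebesgue measure *)

Section affine.
Context {R : realType}.
Notation mu := (@lebesgue_measure R).

Lemma measurable_affine (a b : R) :
  measurable_fun setT
    (fun x : measurableTypeR R => a * x + b : measurableTypeR R).
Proof. by apply: measurable_funD => //; exact: measurable_funM. Qed.

(** The image of the Lebesgue measure by x |-> a x + b, scaled by a, agrees with
    the Lebesgue measure on the intervals ]u, v], hence everywhere. *)
Lemma ge0_integral_affine (f : R -> \bar R) (a b : R) : 0 < a ->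
  measurable_fun setT f -> (forall x, 0 <= f x)%E ->
  (\int[mu]_x f x = a%:E * \int[mu]_x f (a * x + b)%R)%E.
Proof.
move=> a0 mf f0.
pose phi := fun x : measurableTypeR R => a * x + b : measurableTypeR R.
have mphi : measurable_fun setT phi by exact: measurable_affine.
have E A : measurable A ->
    mu A = mscale (NngNum (ltW a0)) (pushforward mu phi) A.
  apply: lebesgue_measure_unique => // X [[u v] /= uv <-].
  rewrite /mscale /= /pushforward.
  have -> : phi @^-1` `]u, v]%classic = `](u - b) / a, (v - b) / a]%classic.
    apply/seteqP; split=> x /=; rewrite !in_itv /=.
      by rewrite ltr_pdivrMr// ler_pdivlMr// ltrBlDr lerBrDr [x * a]mulrC.
    by rewrite ltr_pdivrMr// ler_pdivlMr// ltrBlDr lerBrDr [x * a]mulrC.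
  rewrite !lebesgue_measure_itv /= !lte_fin ltr_pM2r ?invr_gt0// ltrD2r.
  case: ifPn => _; last by rewrite mule0.
  rewrite -!EFinD -EFinM; congr (_%:E); field; exact: lt0r_neq0.
rewrite (@eq_measure_integral _ _ _ _
  (mscale (NngNum (ltW a0)) (pushforward mu phi)))//; last first.
  by move=> A mA _; exact: E.
by rewrite ge0_integral_mscale//= ge0_integral_pushforward.
Qed.

(** The positive and negative parts are transported separately; a factor a > 0
    distributes over the difference of their integrals, even an infinite one. *)
Lemma integral_affine (f : R -> \bar R) (a b : R) : 0 < a ->
  measurable_fun setT f ->
  (\int[mu]_x f x = a%:E * \int[mu]_x f (a * x + b)%R)%E.
Proof.
move=> a0 mf; rewrite integralE [in RHS]integralE.
rewrite (@ge0_integral_affine (f^\+)%E a b)//; last exact: measurable_funepos.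
rewrite (@ge0_integral_affine (f^\-)%E a b)//; last exact: measurable_funeneg.
under [in RHS]eq_integral do rewrite (funepos_comp f (fun x => a * x + b)) /=.
under [X in _ = (_ * (_ - X))%E]eq_integral do
  rewrite (funeneg_comp f (fun x => a * x + b)) /=.
have : (0 <= \int[mu]_x f^\+ (a * x + b)%R)%E by exact: integral_ge0.
have : (0 <= \int[mu]_x f^\- (a * x + b)%R)%E by exact: integral_ge0.
move: (integral _ _ _) (integral _ _ _) => [r| |] [s| |]//= _ _.
- by rewrite -!EFinD -!EFinM mulrBr.
- by rewrite gt0_muley ?lte_fin//= gt0_muleNy ?lte_fin.
- by rewrite gt0_muley ?lte_fin//= gt0_muley ?lte_fin.
- by rewrite /= gt0_muley ?lte_fin//= gt0_muleNy ?lte_fin.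
Qed.

End affine.

(** * Measurability of parametrised integrals and square integrable functions *)

(** The positive and negative parts reduce this to Tonelli.  It serves for the
    measurability of the autocovariance of a process, before any integrability
    in x is available. *)
Lemma measurable_fun_integral_section {R : realType} d1 d2
    (T1 : measurableType d1) (T2 : measurableType d2)
    (m2 : {sigma_finite_measure set T2 -> \bar R}) (f : T1 * T2 -> \bar R) :
  measurable_fun setT f ->
  measurable_fun setT (fun x => \int[m2]_y f (x, y))%E.
Proof.
move=> mf.
have -> : (fun x => \int[m2]_y f (x, y))%E =
    (fun x => \int[m2]_y (f^\+ (x, y)) - \int[m2]_y (f^\- (x, y)))%E.
  apply/funext => x; rewrite integralE.
  under eq_integral do rewrite funepos_comp/=.
  by under [X in (_ - X = _)%E]eq_integral do rewrite funeneg_comp/=.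
apply: emeasurable_funB; apply: measurable_fun_fubini_tonelli_F => //.
  exact: measurable_funepos.
exact: measurable_funeneg.
Qed.

Section square_integrable.
Context d (T : measurableType d) {R : realType}.
Variable m : {measure set T -> \bar R}.

Definition square_integrable (f : T -> R) : Prop :=
  measurable_fun setT f /\ m.-integrable setT (fun x => (f x ^+ 2)%:E).

Lemma Lfun2_square_integrable (f : T -> R) :
  f \in Lfun m 2%:E -> square_integrable f.
Proof.
move=> f2; split; last exact: Lfun2_integrable_sqr.
by move: f2; rewrite inE => /andP[/[!inE]].
Qed.

Lemma square_integrable_mul (f g : T -> R) :
  square_integrable f -> square_integrable g ->
  m.-integrable setT (fun x => (f x * g x)%:E).
Proof.
move=> [mf f2] [mg g2].
apply: (le_integrable measurableT _ _ (integrableD measurableT f2 g2)).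
  by apply/measurable_EFinP; exact: measurable_funM.
move=> x _ /=; rewrite lee_fin [leRHS]ger0_norm ?addr_ge0 ?sqr_ge0// normrM.
rewrite -[f x ^+ 2]real_normK ?num_real// -[g x ^+ 2]real_normK ?num_real//.
by nra.
Qed.

End square_integrable.

(** * Truncation to bounded intervals *)

Section real_line.
Context {R : realType}.
Notation mu := (@lebesgue_measure R).

Lemma cvg_integral_itv (F : R -> \bar R) : mu.-integrable setT F ->
  (fun k : nat => \int[mu]_(x in `[(- k%:R)%R, k%:R%R]) F x)%E @ \oo -->
  (\int[mu]_x F x)%E.
Proof.
move=> iF; pose D (k : nat) : set R := `[- k%:R, k%:R]%classic.
pose Fk k := (F \_ (D k))%E.
have mF : measurable_fun setT F by exact: measurable_int iF.
have [||||_ _] := @dominated_convergence _ _ R mu setT measurableT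
    Fk F (abse \o F) _ mF.
- move=> k; apply: (measurable_restrictT F (measurable_itv _)).1.
  exact: measurable_funTS.
- apply: aeW => x _; apply: cvg_near_cst.
  near=> k; rewrite /Fk patchE mem_set// /D /= in_itv/= -ler_norml.
  by near: k; exact: nbhs_infty_ger.
- exact: integrable_abse.
- apply: aeW => x k _; rewrite /Fk patchE; case: ifPn => //= _.
  by rewrite normr0 abse_ge0.
- by apply: cvg_trans; apply: near_eq_cvg; apply: nearW => k;
    rewrite integral_mkcond.
Unshelve. all: by end_near. Qed.

(** On a bounded interval |f| is dominated by 1 + f^2. *)
Lemma square_integrable_itv (f : R -> R) (a b : R) :
  square_integrable mu f -> mu.-integrable `[a, b] (EFin \o f).
Proof.
move=> [mf f2].
have i1 : mu.-integrable `[a, b] (cst 1%E).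
  apply/integrableP; split; first exact: measurable_cst.
  rewrite (eq_integral (cst 1%E)); last by move=> x _ /=; rewrite normr1.
  rewrite integral_cst//= mul1e lebesgue_measure_itv/=.
  by case: ifPn => _; rewrite ltry.
have mab : measurable (`[a, b] : set (measurableTypeR R)) by [].
have i2 := integrableS measurableT mab (@subsetT _ _) f2.
apply: (le_integrable mab _ _ (integrableD mab i1 i2)).
  by apply/measurable_EFinP; exact: measurable_funTS.
move=> x _ /=; rewrite lee_fin [leRHS]ger0_norm ?addr_ge0 ?sqr_ge0//.
rewrite -[f x ^+ 2]real_normK ?num_real//; nra.
Qed.

End real_line.

(** * Continuity of the covariance for the mean-square norm *)

Section expectation.
Context d {T : measurableType d} {R : realType}.
Variable P : probability T R.

(** Instead of the Cauchy-Schwarz inequality, the elementary bound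
    |Z| |D| <= del Z^2 + D^2 / del is integrated, with D = c - Y k.  The
    convergence makes E(D^2) finite for large k; for these k the product
    Z (Y k) is integrable, as the difference of Z c and Z D. *)
Lemma cvg_expectation_mul (Z c : T -> R) (Y : nat -> T -> R) :
  Z \in Lfun P 2%:E -> c \in Lfun P 2%:E ->
  (forall k, measurable_fun setT (Y k)) ->
  (fun k => 'E_P[fun w => ((c w - Y k w) ^+ 2)%R])%E @ \oo --> 0%E ->
  (fun k => 'E_P[fun w => (Z w * Y k w)%R])%E @ \oo -->
  ('E_P[fun w => (Z w * c w)%R])%E.
Proof.
move=> Z2 c2 mY cY.
have [mZ iZ] := Lfun2_square_integrable Z2.
have [mc ic] := Lfun2_square_integrable c2.
have iZc := square_integrable_mul (conj mZ iZ) (conj mc ic).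
pose E (X : T -> R) := \int[P]_w X w.
have EE (X : T -> R) : P.-integrable setT (EFin \o X) -> 'E_P[X]%E = (E X)%:E.
  by move=> iX; rewrite unlock fineK//; exact: integrable_fin_num.
have bound k (del : R) : 0 < del ->
    'E_P[fun w => ((c w - Y k w) ^+ 2)%R]%E \is a fin_num ->
    P.-integrable setT (EFin \o (fun w => Z w * Y k w)) /\
    `|E (fun w => Z w * c w) - E (fun w => Z w * Y k w)| <=
    del * E (fun w => Z w ^+ 2) +
    del^-1 * fine ('E_P[fun w => ((c w - Y k w) ^+ 2)%R])%E.
  move=> del0 fk.
  have md : measurable_fun setT (fun w => c w - Y k w).
    exact: measurable_funB.
  have id : P.-integrable setT (EFin \o (fun w => (c w - Y k w) ^+ 2)).
    apply/integrableP; split.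
      by apply/measurable_EFinP; exact: measurable_funX.
    move: fk; rewrite unlock fin_numElt => /andP[_]; apply: le_lt_trans.
    rewrite le_eqVlt; apply/orP; left; apply/eqP/eq_integral => w _ /=.
    by rewrite ger0_norm// sqr_ge0.
  have iZd := square_integrable_mul (conj mZ iZ) (conj md id).
  have iZY : P.-integrable setT (EFin \o (fun w => Z w * Y k w)).
    have := integrableB measurableT iZc iZd.
    apply: eq_integrable => // w _ /=; rewrite -EFinB; congr EFin; ring.
  split=> //.
  rewrite -RintegralB// (_ : Rintegral _ _ _ =
      \int[P]_w (Z w * (c w - Y k w))); last first.
    by apply: eq_Rintegral => w _; ring.
  apply: (le_trans (le_normr_Rintegral _ _)) => //.
  have iZ' : P.-integrable setT (EFin \o (fun w => del * Z w ^+ 2)).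
    exact: (integrableZl _ del iZ).
  have id' : P.-integrable setT
      (EFin \o (fun w => del^-1 * (c w - Y k w) ^+ 2)).
    exact: (integrableZl _ del^-1 id).
  rewrite EE// [fine _]/= /E -!RintegralZl// -RintegralD//.
  apply: le_Rintegral => //; first exact: integrable_norm.
    by have := integrableD measurableT iZ' id'.
  move=> w _; rewrite normrM.
  rewrite -[Z w ^+ 2]real_normK ?num_real//.
  rewrite -[(c w - Y k w) ^+ 2]real_normK ?num_real//.
  rewrite -subr_ge0.
  (* the difference of the two sides, after completing the square *)
  have : 0 <= del^-1 * ((del * `|Z w| - `|c w - Y k w|) ^+ 2 +
                         del * `|Z w| * `|c w - Y k w|).
    by rewrite mulr_ge0 ?invr_ge0 ?addr_ge0 ?sqr_ge0// ?mulr_ge0// ltW.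
  by congr (0 <= _); field; exact: lt0r_neq0.
have [fin0 lim0] := (fine_cvgP _ _).1 cY.
rewrite (EE _ iZc); apply/fine_cvgP; split.
  near=> k; have [|iZY _] := @bound k 1 ltr01; first by near: k.
  by rewrite EE.
have A0 : 0 <= E (fun w => Z w ^+ 2).
  by apply: Rintegral_ge0 => w _; exact: sqr_ge0.
apply/cvgrPdist_lt => e e0.
pose A := E (fun w => Z w ^+ 2).
(* this weight makes the first term of the bound less than e / 2 *)
pose del := e / 2 / (A + 1).
have A1 : 0 < A + 1 by rewrite ltr_wpDl.
have del0 : 0 < del by rewrite !divr_gt0.
near=> k.
have [|iZY] := @bound k del del0; first by near: k.
move=> /le_lt_trans; rewrite /= (EE _ iZY) /=; apply.
rewrite [e]splitr; apply: ltrD.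
  by rewrite -/A /del mulrAC ltr_pdivrMr// ltr_pM2l ?divr_gt0// ltrDl.
rewrite mulrC ltr_pdivrMr//; near: k.
have de0 : 0 < e / 2 * del by rewrite mulr_gt0 ?divr_gt0.
move/cvgrPdist_lt : lim0 => /(_ _ de0); apply: filterS => k /=.
by rewrite sub0r normrN; apply: le_lt_trans; exact: ler_norm.
Unshelve. all: by end_near. Qed.

End expectation.

(** * Expectations of mean-square integrals *)

Section process.
Context {R : realType} {d : measure_display} {Omega : measurableType d}.
Variable P : probability Omega R.
Notation mu := (@lebesgue_measure R).
Variables (n : R -> Omega -> R) (Gamma : R -> R).
Hypothesis hn : is_zero_mean_wss P n Gamma.

Lemma wss_integral_sqr x : (\int[P]_w (n x w ^+ 2)%:E)%E = (Gamma 0)%:E.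
Proof.
rewrite -(wss_autocov hn 0 x) unlock; apply: eq_integral => w _.
by rewrite addr0 expr2.
Qed.

(** Gamma inherits its measurability from the joint measurability of n, as
    Gamma(x) = E(n(x) n(0)). *)
Lemma measurable_autocov : measurable_fun setT Gamma.
Proof.
have -> : Gamma = fine \o (fun x => \int[P]_w (n x w * n 0 w)%:E)%E.
  apply/funext => x /=.
  by rewrite -[LHS]/(fine (Gamma x)%:E) -(wss_autocov hn x 0) unlock add0r.
apply: measurableT_comp => //.
apply: (@measurable_fun_integral_section _ _ _ (measurableTypeR R) Omega P
  (fun p => (n p.1 p.2 * n 0 p.2)%:E)).
apply/measurable_EFinP/measurable_funM; first exact: (wss_measurable hn).
apply: measurableT_comp; last exact: measurable_snd.
by have [] := Lfun2_square_integrable (wss_L2 hn 0).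
Qed.

Section weight.
Variables (Z : Omega -> R) (g : R -> R).
Hypotheses (Z2 : Z \in Lfun P 2%:E) (mg : measurable_fun setT g).

Lemma measurable_weighted_process :
  measurable_fun setT (fun p : measurableTypeR R * Omega =>
    (Z p.2 * (n p.1 p.2 * g p.1))%:E).
Proof.
have [mZ _] := Lfun2_square_integrable Z2.
apply/measurable_EFinP/measurable_funM.
  by apply: measurableT_comp => //; exact: measurable_snd.
apply: measurable_funM; first exact: (wss_measurable hn).
by apply: measurableT_comp => //; exact: measurable_fst.
Qed.

Hypothesis ig : mu.-integrable setT (EFin \o g).

(** By stationarity E|Z n(x)| <= E(Z^2) + Gamma(0) uniformly in x. *)
Lemma integrable_weighted_process :
  (mu \x P)%E.-integrable setT (fun p : measurableTypeR R * Omega =>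
    (Z p.2 * (n p.1 p.2 * g p.1))%:E).
Proof.
have [mZ iZ] := Lfun2_square_integrable Z2.
apply/integrable12ltyP; first exact: measurable_weighted_process.
pose K := (\int[P]_w (Z w ^+ 2)%:E + (Gamma 0)%:E)%E.
have finK : K \is a fin_num by rewrite fin_numD integrable_fin_num.
have K0 : (0 <= K)%E.
  rewrite adde_ge0//.
    by apply: integral_ge0 => w _; rewrite lee_fin sqr_ge0.
  rewrite -(wss_integral_sqr 0).
  by apply: integral_ge0 => w _; rewrite lee_fin sqr_ge0.
have sec x : (\int[P]_w `|(Z w * (n x w * g x))%:E| <= K * `|(g x)%:E|)%E.
  have [mn inn] := Lfun2_square_integrable (wss_L2 hn x).
  have Zn := square_integrable_mul (conj mZ iZ) (conj mn inn).
  under eq_integral do rewrite mulrA EFinM abseM.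
  rewrite ge0_integralZr//; last first.
    by apply: measurableT_comp => //; exact: measurable_int Zn.
  rewrite lee_wpmul2r// /K -(wss_integral_sqr x) -ge0_integralD//; last 4 first.
  - by move=> w _; rewrite lee_fin sqr_ge0.
  - exact: measurable_int iZ.
  - by move=> w _; rewrite lee_fin sqr_ge0.
  - exact: measurable_int inn.
  apply: ge0_le_integral => //.
  - by apply: measurableT_comp => //; exact: measurable_int Zn.
  - apply: emeasurable_funD; first exact: measurable_int iZ.
    exact: measurable_int inn.
  - move=> w _; rewrite lee_fin normrM.
    rewrite -[Z w ^+ 2]real_normK ?num_real//.
    by rewrite -[n x w ^+ 2]real_normK ?num_real//; nra.
apply: (@le_lt_trans _ _ (\int[mu]_x (K * `|(g x)%:E|))%E).
  apply: ge0_le_integral => //.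
  - by move=> x _; exact: integral_ge0.
  - apply: (@measurable_fun_integral_section _ _ _ (measurableTypeR R) Omega P
      (fun p => `|(Z p.2 * (n p.1 p.2 * g p.1))%:E|%E)).
    by apply: measurableT_comp => //; exact: measurable_weighted_process.
  - apply: measurable_funeM; apply: measurableT_comp => //.
    exact/measurable_EFinP.
  - by move=> x _; exact: sec.
rewrite -(fineK finK) ge0_integralZl_EFin//; last 2 first.
- by apply: measurableT_comp => //; exact/measurable_EFinP.
- exact: fine_ge0.
move/integrableP : ig => [_ lt]; rewrite lte_mul_pinfty//.
by rewrite lee_fin fine_ge0.
Qed.

End weight.

Section pathwise_integral.
Variable g : R -> R.
Hypotheses (mg : measurable_fun setT g) (ig : mu.-integrable setT (EFin \o g)).

Lemma measurable_pathwise_integral :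
  measurable_fun setT (fun w => \int[mu]_x (n x w * g x)).
Proof.
have := measurable_fubini_G
  (integrable_weighted_process (Lfun_cst P 1 2) mg ig).
move=> m1; apply: measurableT_comp => //.
apply: eq_measurable_fun m1 => w _; apply: eq_integral => x _ /=.
by rewrite mul1r.
Qed.

(** Fubini, for the product of Z with a pathwise integral.  The integral over
    the line is finite for almost every w, except possibly where Z w = 0: there
    both sides vanish. *)
Lemma expectation_pathwise_integral (Z : Omega -> R) : Z \in Lfun P 2%:E ->
  ('E_P[fun w => (Z w * \int[mu]_x (n x w * g x))%R] =
   \int[mu]_x \int[P]_w (Z w * (n x w * g x))%:E)%E.
Proof.
move=> Z2; have [mZ _] := Lfun2_square_integrable Z2.
have iF := integrable_weighted_process Z2 mg ig.
rewrite (Fubini iF) unlock; apply: ae_eq_integral => //.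
- apply/measurable_EFinP/measurable_funM => //.
  exact: measurable_pathwise_integral.
- exact: measurable_fubini_G iF.
have := ae_integrable2 iF; apply: filterS => w /= iw _.
have [Zw0|Zw0] := eqVneq (Z w) 0.
  by rewrite Zw0 mul0r integral0_eq// => x _; rewrite mul0r.
have inw : mu.-integrable setT (EFin \o (fun x => n x w * g x)).
  have := integrableZl measurableT (Z w)^-1 iw.
  by apply: eq_integrable => // x _ /=; rewrite -EFinM mulKf.
under [RHS]eq_integral do rewrite EFinM.
by rewrite integralZl// EFinM fineK// integrable_fin_num.
Qed.

End pathwise_integral.

(** The mean-square integral is characterised through its scalar products with
    square integrable variables.  The integrand E(Z n(x)) f(x) is only
    prescribed almost everywhere, because in the applications it is computed by
    Fubini. *)
Lemma expectation_ms_integral (f : R -> R) (h : R -> \bar R)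
    (c Z : Omega -> R) :
  square_integrable mu f -> is_ms_integral P n f c -> Z \in Lfun P 2%:E ->
  mu.-integrable setT h ->
  {ae mu, forall x, (\int[P]_w (Z w * (n x w * f x))%:E)%E = h x} ->
  ('E_P[fun w => (Z w * c w)%R] = \int[mu]_x h x)%E.
Proof.
move=> f2 [c2 cY] Z2 ih Zh; have [mf _] := f2.
pose D (k : nat) : set (measurableTypeR R) := `[- k%:R, k%:R]%classic.
pose g k := f \_ (D k).
have mg k : measurable_fun setT (g k).
  have mD : measurable (D k) by exact: measurable_itv.
  apply: (measurable_restrictT f mD).1.
  exact: (measurable_funS measurableT (@subsetT _ _) mf).
have ig k : mu.-integrable setT (EFin \o g k).
  have := square_integrable_itv (- k%:R) k%:R f2.
  move/integrable_mkcond => /(_ (measurable_itv _)).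
  by apply: eq_integrable => // x _ /=; rewrite /g !patchE; case: ifPn.
pose Y k w := \int[mu]_x (n x w * g k x).
have YE k w : \int[mu]_(x in D k) (n x w * f x) = Y k w.
  rewrite Rintegral_mkcond; apply: eq_Rintegral => x _.
  by rewrite /g !patchE; case: ifPn; rewrite ?mulr0.
have cv1 : (fun k => 'E_P[fun w => (Z w * Y k w)%R])%E @ \oo -->
    ('E_P[fun w => (Z w * c w)%R])%E.
  apply: cvg_expectation_mul => //.
    by move=> k; exact: (measurable_pathwise_integral (mg k) (ig k)).
  have := cvg_comp _ _ (cvgr_idn (R := R)) cY.
  apply: cvg_trans; apply: near_eq_cvg; apply: nearW => k /=.
  by congr (expectation _ _); apply/funext => w; rewrite -YE.
have cv2 : (fun k => 'E_P[fun w => (Z w * Y k w)%R])%E @ \oo -->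
    (\int[mu]_x h x)%E.
  have := cvg_integral_itv ih.
  apply: cvg_trans; apply: near_eq_cvg; apply: nearW => k /=.
  rewrite (expectation_pathwise_integral (mg k) (ig k) Z2) integral_mkcond.
  apply: ae_eq_integral => //.
  - apply: (measurable_restrictT _ (measurable_itv _)).1.
    by apply: measurable_funTS; exact: measurable_int ih.
  - exact: measurable_fubini_F (integrable_weighted_process Z2 (mg k) (ig k)).
  apply: (@filterS _ _ (ae_filter_ringOfSetsType mu) _ _ _ Zh) => x Zhx _ /=.
  rewrite /g !patchE; case: ifPn => _; first by rewrite -Zhx.
  by rewrite integral0_eq// => w _; rewrite !mulr0.
exact: (cvg_unique _ cv1 cv2).
Qed.

End process.

(** * Correlations of square integrable functions and of atoms *)

Section crosscorrelation.
Context {R : realType}.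
Notation mu := (@lebesgue_measure R).

Lemma measurable_comp_affine d' (U : measurableType d') (f : R -> U) (a b : R) :
  measurable_fun setT f -> measurable_fun setT (fun x => f (a * x + b)).
Proof.
by move=> mf; apply: (measurableT_comp mf); exact: measurable_affine.
Qed.

Lemma integrable_affine (F : R -> \bar R) (a b : R) : 0 < a ->
  mu.-integrable setT F -> mu.-integrable setT (fun x => F (a * x + b)).
Proof.
move=> a0 /integrableP[mF iF]; have mFab := measurable_comp_affine a b mF.
apply/integrableP; split => //.
rewrite (@integral_affine _ _ a^-1 (- (a^-1 * b))) ?invr_gt0//; last first.
  exact: measurableT_comp.
rewrite (eq_integral (fun x : measurableTypeR R => `|F x|%E)); last first.
  move=> x _; congr (`|F _|%E); field; exact: lt0r_neq0.
by rewrite lte_mul_pinfty// lee_fin invr_ge0 ltW.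
Qed.

Lemma square_integrable_affine (f : R -> R) (a b : R) : 0 < a ->
  square_integrable mu f -> square_integrable mu (fun x => f (a * x + b)).
Proof.
move=> a0 [mf if2]; split; first exact: measurable_comp_affine.
exact: (integrable_affine b a0 if2).
Qed.

Lemma square_integrable_norm (f : R -> R) :
  square_integrable mu f -> square_integrable mu (Num.norm \o f).
Proof.
move=> [mf if2]; split; first exact: measurableT_comp.
by apply: eq_integrable if2 => // x _ /=; rewrite real_normK// num_real.
Qed.

Lemma integrable_crosscorr (f g : R -> R) (t : R) :
  square_integrable mu f -> square_integrable mu g ->
  mu.-integrable setT (fun x => (f x * g (x - t))%:E).
Proof.
move=> f2 g2; apply: square_integrable_mul => //.
have := square_integrable_affine (- t) ltr01 g2.
by congr square_integrable; apply/funext => x; rewrite mul1r.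
Qed.

Lemma EFin_crosscorr (f g : R -> R) (t : R) :
  square_integrable mu f -> square_integrable mu g ->
  (crosscorr f g t)%:E = (\int[mu]_x (f x * g (x - t))%:E)%E.
Proof.
move=> f2 g2; rewrite /crosscorr /Rintegral fineK//.
exact: integrable_fin_num (integrable_crosscorr t f2 g2).
Qed.

End crosscorrelation.

Section atoms.
Context {R : realType}.
Notation mu := (@lebesgue_measure R).
Variables (M : nat) (j : int).
Hypothesis M0 : (0 < M)%N.

Lemma atom_scaleE : (M%:R `^ (- (j%:~R / 2))) * (M%:R `^ (- (j%:~R / 2))) =
  M%:R ^ (- j) :> R.
Proof.
rewrite -powRD; last by rewrite pnatr_eq0 -lt0n M0 implybT.
rewrite -powR_intmul//; congr (_ `^ _); rewrite intrN; lra.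
Qed.

Lemma atom_norm (f : R -> R) k x :
  atom M (Num.norm \o f) j k x = `|atom M f j k x|.
Proof. by rewrite /atom normrM (ger0_norm (powR_ge0 _ _)). Qed.

Lemma square_integrable_atom (f : R -> R) k :
  square_integrable mu f -> square_integrable mu (atom M f j k).
Proof.
move=> f2.
have b0 : 0 < M%:R ^ (- j) :> R by rewrite exprz_gt0// ltr0n.
have [mf if2] := square_integrable_affine (- k%:~R) b0 f2.
split; first exact: measurable_funM.
have := integrableZl measurableT (M%:R ^ (- j)) if2.
apply: eq_integrable => // x _ /=.
by rewrite -EFinM exprMn -atom_scaleE -[in RHS]expr2.
Qed.

(** The substitution u = M^(-j) (z + y) - (k + l) turns the atoms into f(u) and
    g(u - (z / M^j - l)); its Jacobian M^(-j) is the product of the two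
    normalisation factors M^(-j/2) of the atoms. *)
Lemma integral_atom_mul (f g : R -> R) (l k : int) (z : R) :
  square_integrable mu f -> square_integrable mu g ->
  (\int[mu]_y (atom M f j (k + l) (z + y) * atom M g j k y)%:E)%E =
  (crosscorr f g (z / M%:R ^ j - l%:~R))%:E.
Proof.
move=> f2 g2; rewrite EFin_crosscorr//.
have ifg := integrable_crosscorr (z / M%:R ^ j - l%:~R) f2 g2.
have b0 : 0 < M%:R ^ (- j) :> R by rewrite exprz_gt0// ltr0n.
rewrite [RHS](@integral_affine _ _ (M%:R ^ (- j))
  (M%:R ^ (- j) * z - (k + l)%:~R))//; last first.
  exact: measurable_int ifg.
rewrite -integralZl//; last exact: integrable_affine ifg.
apply: eq_integral => y _; rewrite -EFinM /atom; congr EFin.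
have -> : M%:R ^ j = (M%:R ^ (- j))^-1 :> R by rewrite -invr_expz invrK.
rewrite invrK -[X in _ = X * (f _ * _)]atom_scaleE mulrACA.
by congr (_ * (f _ * g _)); rewrite intrD; ring.
Qed.

End atoms.

(** * Covariances of the coefficients *)

Section covariance.
Context {R : realType} {d : measure_display} {Omega : measurableType d}.
Variable P : probability Omega R.
Notation mu := (@lebesgue_measure R).
Variables (n : R -> Omega -> R) (Gamma : R -> R).
Hypothesis hn : is_zero_mean_wss P n Gamma.

(** Scalar product with Z = 1. *)
Lemma mean_ms_integral (f : R -> R) (c : Omega -> R) :
  square_integrable mu f -> is_ms_integral P n f c -> 'E_P[c]%E = 0%E.
Proof.
move=> f2 hc.
transitivity ('E_P[fun w => (cst 1 w * c w)%R])%E.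
  by congr (expectation _ _); apply/funext => w; rewrite mul1r.
rewrite (@expectation_ms_integral _ _ _ _ _ _ hn f (cst 0%E) c)//.
- exact: integral0.
- exact: Lfun_cst.
- exact: integrable0.
apply: aeW => x.
have := wss_mean hn x; rewrite unlock => nx0.
transitivity (\int[P]_w ((n x w)%:E * (f x)%:E))%E.
  by apply: eq_integral => w _; rewrite mul1r EFinM.
rewrite integralZr//= ?nx0 ?mul0e//.
apply/Lfun1_integrable/(Lfun_subset12 _ (wss_L2 hn x)).
exact: fin_num_measure.
Qed.

(** Scalar product with Z = n(y), where E(n(y) n(x)) = Gamma(x - y); the
    integral is recentred by x = z + y. *)
Lemma expectation_process_ms_integral (f : R -> R) (c : Omega -> R) (y : R) :
  square_integrable mu f -> is_ms_integral P n f c ->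
  mu.-integrable setT (fun z => (Gamma z * f (z + y))%:E) ->
  ('E_P[fun w => (n y w * c w)%R] = \int[mu]_z (Gamma z * f (z + y))%:E)%E.
Proof.
move=> f2 hc ifG.
have E : (fun x => (Gamma (x - y) * f x)%:E) =
         (fun x => (Gamma (1 * x - y) * f (1 * x - y + y))%:E).
  by apply/funext => x; rewrite mul1r subrK.
have ih : mu.-integrable setT (fun x => (Gamma (x - y) * f x)%:E).
  by rewrite E; exact: (integrable_affine (- y) ltr01 ifG).
rewrite (expectation_ms_integral hn f2 hc (wss_L2 hn y) ih).
  rewrite E [RHS](@integral_affine _ _ 1 (- y))// ?mul1e//.
  exact: measurable_int ifG.
apply: aeW => x.
transitivity (\int[P]_w ((n x w * n y w)%:E * (f x)%:E))%E.
  by apply: eq_integral => w _; rewrite -EFinM; congr EFin; ring.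
rewrite integralZr//; last first.
  by apply: square_integrable_mul; apply: Lfun2_square_integrable;
    exact: (wss_L2 hn).
have := wss_autocov hn (x - y) y; rewrite unlock addrC subrK => ->.
by rewrite EFinM.
Qed.

(** Scalar product with Z = c.  For almost every y with g(y) <> 0 the section
    z |-> Gamma(z) f(z + y) is integrable, so E(n(y) c) is given by the previous
    lemma; where g(y) = 0 both integrands vanish. *)
Lemma covariance_ms_integrals (f g : R -> R) (c c' : Omega -> R) :
  square_integrable mu f -> square_integrable mu g ->
  is_ms_integral P n f c -> is_ms_integral P n g c' ->
  (\int[mu]_z \int[mu]_y `|(Gamma z * (f (z + y) * g y))%:E| < +oo)%E ->
  ('E_P[fun w => (c w * c' w)%R] =
   \int[mu]_z \int[mu]_y (Gamma z * (f (z + y) * g y))%:E)%E.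
Proof.
move=> f2 g2 hc hc' fin.
have [mf _] := f2; have [mg _] := g2.
pose B (p : measurableTypeR R * measurableTypeR R) :=
  (Gamma p.2 * (f (p.2 + p.1) * g p.1))%:E.
have mB : measurable_fun setT B.
  apply/measurable_EFinP/measurable_funM.
    apply: measurableT_comp; last exact: measurable_snd.
    exact: (measurable_autocov hn).
  apply: measurable_funM; apply: measurableT_comp => //.
  by apply: measurable_funD; [exact: measurable_snd|exact: measurable_fst].
have iB : (mu \x mu)%E.-integrable setT B by apply/integrable21ltyP.
rewrite (expectation_ms_integral hn g2 hc' hc.1 (integrable_fubini_F iB)).
  exact: (Fubini iB).
have := ae_integrable1 iB.
apply: (@filterS _ _ (ae_filter_ringOfSetsType mu)) => y iBy.
rewrite /fubini_F /B /=.
have [gy0|gy0] := eqVneq (g y) 0.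
  by rewrite gy0 !integral0_eq// => ? _; rewrite !mulr0.
have iy : mu.-integrable setT (fun z => (Gamma z * f (z + y))%:E).
  have := integrableZr measurableT (g y)^-1 iBy.
  by apply: eq_integrable => // z _; rewrite /B /= -EFinM mulrA mulfK.
transitivity (\int[P]_w ((n y w * c w)%:E * (g y)%:E))%E.
  by apply: eq_integral => w _; rewrite -EFinM; congr EFin; ring.
rewrite integralZr//; last first.
  apply: square_integrable_mul; apply: Lfun2_square_integrable.
    exact: (wss_L2 hn).
  exact: hc.1.
have := expectation_process_ms_integral f2 hc iy; rewrite unlock => ->.
by rewrite -integralZr//; apply: eq_integral => z _; rewrite -EFinM mulrA.
Qed.

(** The absolute values of the atoms are the atoms of the absolute values, so
    that one evaluation of the inner integral provides both the absolute
    convergence of the double integral and its value. *)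
Lemma covariance_coefficients (M : nat) (j l k : int) (f g : R -> R)
    (c c' : Omega -> R) : (0 < M)%N ->
  square_integrable mu f -> square_integrable mu g ->
  is_ms_integral P n (atom M f j (k + l)) c ->
  is_ms_integral P n (atom M g j k) c' ->
  covariance_integral_converges M j Gamma f g ->
  'E_P[fun w => (c w * c' w)%R]%E = covariance_integral M j Gamma f g l.
Proof.
move=> M0 f2 g2 hc hc' conv.
have fa2 := square_integrable_atom j M0 (k + l) f2.
have ga2 := square_integrable_atom j M0 k g2.
have iz z : mu.-integrable setT (fun y =>
    (atom M f j (k + l) (z + y) * atom M g j k y)%:E).
  apply: square_integrable_mul => //.
  have -> : (fun y => atom M f j (k + l) (z + y)) =
      (fun y => atom M f j (k + l) (1 * y + z)).
    by apply/funext => y; rewrite mul1r [z + y]addrC.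
  exact: (square_integrable_affine z ltr01 fa2).
rewrite (covariance_ms_integrals fa2 ga2 hc hc').
  apply: eq_integral => z _.
  under eq_integral do rewrite EFinM.
  by rewrite integralZl// integral_atom_mul// EFinM.
have := conv l; rewrite /covariance_integral; apply: le_lt_trans.
rewrite le_eqVlt; apply/orP; left; apply/eqP/eq_integral => z _ /=.
have := square_integrable_norm g2; have := square_integrable_norm f2.
move=> nf2 ng2; rewrite EFinM -(integral_atom_mul j M0 l k z nf2 ng2).
under eq_integral do rewrite normrM EFinM.
rewrite integralZl//.
  by congr (_ * _)%E; apply: eq_integral => y _; rewrite !atom_norm normrM.
exact: integrable_norm (iz z).
Qed.

End covariance.

Theorem proposition1 (R : realType)
  (M : nat) (hM : (2 <= M)%N) (d : int)
  (psi psiH : nat -> R -> R) (hat hatH H : nat -> R -> R[i])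
  (hpsi : is_mband_wavelets M psi hat H)
  (hpsiH : is_dual_wavelets M d psi psiH hat hatH)
  (disp : measure_display) (Omega : measurableType disp)
  (P : probability Omega R)
  (n : R -> Omega -> R) (Gamma : R -> R)
  (hn : is_zero_mean_wss P n Gamma)
  (j : int)
  (hconv : forall m m' : nat, (m < M)%N -> (m' < M)%N ->
     [/\ covariance_integral_converges M j Gamma (psi m) (psi m'),
         covariance_integral_converges M j Gamma (psiH m) (psiH m') &
         covariance_integral_converges M j Gamma (psi m) (psiH m')])
  (c cH : nat -> int -> Omega -> R)
  (hc : is_wavelet_coefficients P M psi n j c)
  (hcH : is_wavelet_coefficients P M psiH n j cH) :
  forall m m' : nat, (m < M)%N -> (m' < M)%N ->
    is_wss_vector_sequence P
      (fun k (dual : bool) => if dual then cH m k else c m k) /\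
    has_crosscov P (c m) (c m')
      (covariance_integral M j Gamma (psi m) (psi m')) /\
    has_crosscov P (cH m) (cH m')
      (covariance_integral M j Gamma (psiH m) (psiH m')) /\
    has_crosscov P (c m) (cH m')
      (covariance_integral M j Gamma (psi m) (psiH m')).
Proof.
have M0 : (0 < M)%N by exact: leq_trans hM.
have s2 m (mM : (m < M)%N) := Lfun2_square_integrable (mband_L2 hpsi mM).
have sH2 m (mM : (m < M)%N) := Lfun2_square_integrable (dual_L2 hpsiH mM).
have cc m m' : (m < M)%N -> (m' < M)%N -> has_crosscov P (c m) (c m')
    (covariance_integral M j Gamma (psi m) (psi m')).
  move=> mM m'M l k; have [conv _ _] := hconv _ _ mM m'M.
  exact: (covariance_coefficients hn M0 (s2 _ mM) (s2 _ m'M)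
    (hc _ mM _) (hc _ m'M _) conv).
have cHcH m m' : (m < M)%N -> (m' < M)%N -> has_crosscov P (cH m) (cH m')
    (covariance_integral M j Gamma (psiH m) (psiH m')).
  move=> mM m'M l k; have [_ conv _] := hconv _ _ mM m'M.
  exact: (covariance_coefficients hn M0 (sH2 _ mM) (sH2 _ m'M)
    (hcH _ mM _) (hcH _ m'M _) conv).
have ccH m m' : (m < M)%N -> (m' < M)%N -> has_crosscov P (c m) (cH m')
    (covariance_integral M j Gamma (psi m) (psiH m')).
  move=> mM m'M l k; have [_ _ conv] := hconv _ _ mM m'M.
  exact: (covariance_coefficients hn M0 (s2 _ mM) (sH2 _ m'M)
    (hc _ mM _) (hcH _ m'M _) conv).
move=> m m' mM m'M; split; last first.
  by split; [exact: cc | split; [exact: cHcH | exact: ccH]].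
split; first by move=> k []; [have [] := hcH _ mM k|have [] := hc _ mM k].
split.
  have mean0 k a : 'E_P[if a then cH m k else c m k]%E = 0%E.
    case: a.
      have at2 := square_integrable_atom j M0 k (sH2 _ mM).
      exact: (mean_ms_integral hn at2 (hcH _ mM k)).
    have at2 := square_integrable_atom j M0 k (s2 _ mM).
    exact: (mean_ms_integral hn at2 (hc _ mM k)).
  by move=> k k' a; rewrite !mean0.
have cHc l k : 'E_P[fun w => (cH m (k + l) w * c m k w)%R]%E =
    covariance_integral M j Gamma (psi m) (psiH m) (- l).
  (* the pair read from the time k + l has lag - l *)
  rewrite -(ccH _ _ mM mM _ (k + l)) addrK.
  by congr (expectation _ _); apply/funext => w; rewrite mulrC.
move=> l k k' [] []; rewrite ?cHc//.
- by rewrite !(cHcH _ _ mM mM).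
- by rewrite !(ccH _ _ mM mM).
- by rewrite !(cc _ _ mM mM).
Qed.
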